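(* Let $E: y^2=x^3-2x$ and $P=(2,2)\in E(\mathbb{Q})$. For any integer $n\ge0$ and any prime $p$ with $p\mid F_n(E,P)$: if $p\equiv1\pmod 4$ then $p\equiv 1\pmod{2^n}$, and if $p\equiv -1\pmod 4$ then $p\equiv -1\pmod{2^n}$.
   Context: $P=(2,2)$ has infinite order on $E$. For $k\ge0$ write $2^kP=\left(\frac{m_k}{e_k^2},\frac{n_k}{e_k^3}\right)$ with $m_k,n_k,e_k\in\mathbb{Z}$, $e_k\ge1$, $\gcd(m_k,e_k)=\gcd(n_k,e_k)=1$. Define $F_0(E,P)=e_0$ and $F_k(E,P)=e_k/e_{k-1}$ for $k\ge1$. *)

(* Defs.v *)
From HB Require Import structures.
From mathcomp Require Import all_boot all_order all_algebra ring.
Set Implicit Arguments. Unset Strict Implicit. Unset Printing Implicit Defensive.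
Import Order.TTheory GRing.Theory Num.Theory.
Local Open Scope ring_scope.

(* Short Weierstrass curve y^2 = x^3 + a x + b; the discriminant condition also
   forces characteristic <> 2. *)
Record ecurve (F : fieldType) := ECurve {
  ec_a : F;
  ec_b : F;
  ec_disc : - 16%:R * (4%:R * ec_a ^+ 3 + 27%:R * ec_b ^+ 2) != 0 }.

Section Raw.
Variables (F : fieldType) (E : ecurve F).
Local Notation a := (ec_a E).
Local Notation b := (ec_b E).

(* [None] is the point at infinity. *)
Definition on_ec (p : option (F * F)) : bool :=
  if p is Some (x, y) then y ^+ 2 == x ^+ 3 + a * x + b else true.

Definition ec_opp_raw (p : option (F * F)) : option (F * F) :=
  if p is Some (x, y) then Some (x, - y) else None.

Definition ec_slope (x1 y1 x2 y2 : F) : F :=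
  if x1 == x2 then (3%:R * x1 ^+ 2 + a) / (2%:R * y1) else (y2 - y1) / (x2 - x1).

Definition ec_add_raw (p q : option (F * F)) : option (F * F) :=
  match p, q with
  | None, _ => q
  | _, None => p
  | Some (x1, y1), Some (x2, y2) =>
      if (x1 == x2) && (y1 == - y2) then None
      else
        let l := ec_slope x1 y1 x2 y2 in
        let x3 := l ^+ 2 - x1 - x2 in
        Some (x3, l * (x1 - x3) - y1)
  end.

Lemma ec_two_neq0 : 2%:R != 0 :> F.
Proof.
apply: contra (ec_disc E) => /eqP h2.
have -> : 16%:R = 2%:R * 8%:R :> F by rewrite -natrM.
by rewrite h2 mul0r oppr0 mul0r.
Qed.

Lemma ec_nonsing x : x ^+ 3 + a * x + b = 0 -> 3%:R * x ^+ 2 + a != 0.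
Proof.
move=> hf; apply: contra (ec_disc E) => /eqP hd; apply/eqP.
have ha : a = - (3%:R * x ^+ 2) by apply/eqP; rewrite -addr_eq0 addrC hd.
have hb : b = 2%:R * x ^+ 3.
  by rewrite -[b]subr0 -hf ha; ring.
by rewrite hb ha; ring.
Qed.

Local Notation add := ec_add_raw.
Local Notation opp := ec_opp_raw.

(* For two points of the curve that are not opposite, these two equations hold
   exactly when l is the slope of the chord (or of the tangent if they coincide). *)
Definition ec_line l (x1 y1 x2 y2 : F) :=
  y1 - y2 = l * (x1 - x2) /\ l * (y1 + y2) = x1 ^+ 2 + x1 * x2 + x2 ^+ 2 + a.

Lemma ec_sqr_opp_or (y1 y2 : F) : y1 ^+ 2 = y2 ^+ 2 -> y1 != - y2 -> y1 = y2.
Proof.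
move=> /eqP; rewrite eqf_sqr => /orP[/eqP// | /eqP ->]; by rewrite eqxx.
Qed.

Lemma ec_two_y_neq0 (y : F) : y != - y -> y != 0.
Proof. by apply: contra => /eqP ->; rewrite oppr0. Qed.

Variant ec_add_spec x1 y1 x2 y2 : option (F * F) -> Type :=
 | EcAddO of x1 = x2 & y1 = - y2 : ec_add_spec x1 y1 x2 y2 None
 | EcAddL l of (x1, y1) <> (x2, - y2) & ec_line l x1 y1 x2 y2 &
     l = ec_slope x1 y1 x2 y2:
     ec_add_spec x1 y1 x2 y2
       (Some (l ^+ 2 - x1 - x2, l * (x1 - (l ^+ 2 - x1 - x2)) - y1)).

Lemma ec_addP x1 y1 x2 y2 : on_ec (Some (x1, y1)) -> on_ec (Some (x2, y2)) ->
  ec_add_spec x1 y1 x2 y2 (add (Some (x1, y1)) (Some (x2, y2))).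
Proof.
move=> /= /eqP h1 /eqP h2; case: ifP => [/andP[/eqP ? /eqP ?]|hn]; first exact: EcAddO.
apply: EcAddL => //; first by case=> /eqP e1 /eqP e2; rewrite e1 e2 in hn.
rewrite /ec_line /ec_slope; have [e|ne] := eqVneq x1 x2.
  subst x2; move: hn; rewrite eqxx /= => /negbT hn.
  have ey : y1 = y2 by apply: ec_sqr_opp_or hn; rewrite h1 h2.
  subst y2; split; first by rewrite !subrr mulr0.
  have y0 := ec_two_y_neq0 hn; have t0 := ec_two_neq0.
  by field; rewrite y0 t0.
have nz : x2 - x1 != 0 by rewrite subr_eq0 eq_sym.
split; first by field.
have -> : (y2 - y1) / (x2 - x1) * (y1 + y2) = (y2 ^+ 2 - y1 ^+ 2) / (x2 - x1) by field.
by rewrite h1 h2; field.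
Qed.

Lemma ec_on_line l x1 y1 x2 y2 x3 : ec_line l x1 y1 x2 y2 -> on_ec (Some (x1,y1)) ->
  x3 = l ^+ 2 - x1 - x2 -> on_ec (Some (x3, l * (x1 - x3) - y1)).
Proof.
move=> [e1 e2] /= /eqP h1 ->; apply/eqP.
have y2E : y2 = y1 - l * (x1 - x2) by rewrite -e1; ring.
have aE : a = l * (y1 + y2) - (x1 ^+ 2 + x1 * x2 + x2 ^+ 2) by rewrite e2; ring.
have bE : b = y1 ^+ 2 - x1 ^+ 3 - a * x1 by rewrite h1; ring.
by rewrite bE aE y2E; ring.
Qed.

Lemma ec_add_on p q : on_ec p -> on_ec q -> on_ec (add p q).
Proof.
case: p => [[x1 y1]|] //; case: q => [[x2 y2]|] // hp hq.
by case: ec_addP => // l _ hl _; apply: ec_on_line hl hp _.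
Qed.

Lemma ec_opp_on p : on_ec p -> on_ec (opp p).
Proof. by case: p => [[x y]|] //=; rewrite sqrrN. Qed.

(* Eliminating y1, y3, a and then y2 turns associativity of the generic sum into
   an identity of rational functions in x1, x2, x3, l, m. *)
Lemma ec_gen_x (x1 x2 x3 y1 y2 y3 l m : F) :
  ec_line l x1 y1 x2 y2 -> ec_line m x2 y2 x3 y3 -> l != m ->
  let xs := l ^+ 2 - x1 - x2 in let ys := l * (x1 - xs) - y1 in
  let xt := m ^+ 2 - x2 - x3 in let yt := m * (x2 - xt) - y2 in
  xs - x3 != 0 -> x1 - xt != 0 ->
  let u := (ys - y3) / (xs - x3) in let v := (y1 - yt) / (x1 - xt) in
  u ^+ 2 - xs - x3 = v ^+ 2 - x1 - xt /\
  u * (xs - (u ^+ 2 - xs - x3)) - ys = v * (x1 - (v ^+ 2 - x1 - xt)) - y1.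
Proof.
move=> [e1 e2] [f1 f2] nlm.
have t0 := ec_two_neq0.
have nz : l - m != 0 by rewrite subr_eq0.
have y1E : y1 = y2 + l * (x1 - x2) by rewrite -e1; ring.
have y3E : y3 = y2 - m * (x2 - x3) by rewrite -f1; ring.
have y2E : y2 = ((x1-x3)*(x1+x2+x3) - l^+2*(x1-x2)+m^+2*(x3-x2)) / (2%:R * (l - m)).
  have aE : a = l * (y1 + y2) - (x1 ^+ 2 + x1 * x2 + x2 ^+ 2) by rewrite e2; ring.
  have R : 2%:R * (l - m) * y2 = (x1-x3)*(x1+x2+x3) - l^+2*(x1-x2)+m^+2*(x3-x2).
    move: f2; rewrite aE y1E y3E => /eqP; rewrite -subr_eq0 => /eqP R.
    by apply/eqP; rewrite -subr_eq0 -oppr_eq0; apply/eqP; rewrite -R; ring.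
  by rewrite -R; field; rewrite t0 nz.
move=> xs ys xt yt n1 n2 u v.
rewrite /u /v /ys /yt y1E y3E y2E.
split.
all: rewrite /xs /xt in n1 n2 *; field; rewrite ?t0 ?nz ?n1 ?n2 //=.
Qed.

Lemma ec_line_chord x1 y1 x2 y2 : on_ec (Some (x1, y1)) -> on_ec (Some (x2, y2)) ->
  x1 - x2 != 0 -> ec_line ((y1 - y2) / (x1 - x2)) x1 y1 x2 y2.
Proof.
move=> /= /eqP h1 /eqP h2 nz; split; first by field.
have -> : (y1 - y2) / (x1 - x2) * (y1 + y2) = (y1 ^+ 2 - y2 ^+ 2) / (x1 - x2) by field.
by rewrite h1 h2; field.
Qed.

Lemma ec_line_tangent x y : y != 0 -> ec_line ((3%:R * x ^+ 2 + a) / (2%:R * y)) x y x y.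
Proof.
move=> y0; have t0 := ec_two_neq0.
by split; [rewrite !subrr mulr0 | field; rewrite y0 t0].
Qed.

Lemma ec_line_sym l x1 y1 x2 y2 : ec_line l x1 y1 x2 y2 -> ec_line l x2 y2 x1 y1.
Proof.
case=> e1 e2; split; last by rewrite addrC e2; ring.
by rewrite -opprB e1; ring.
Qed.

Lemma ec_add_line l x1 y1 x2 y2 : on_ec (Some (x1, y1)) -> on_ec (Some (x2, y2)) ->
  (x1, y1) <> (x2, - y2) -> ec_line l x1 y1 x2 y2 ->
  add (Some (x1, y1)) (Some (x2, y2)) =
  Some (l ^+ 2 - x1 - x2, l * (x1 - (l ^+ 2 - x1 - x2)) - y1).
Proof.
move=> h1 h2; case: ec_addP => // [-> -> //|k n [e1 e2] _ _ [f1 f2]].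
suff -> : k = l by [].
have [e|ne] := eqVneq x1 x2; last first.
  have nz : x1 - x2 != 0 by rewrite subr_eq0.
  by apply: (mulIf nz); rewrite -e1 -f1.
subst x2; move/eqP: e1; rewrite subrr mulr0 subr_eq0 => /eqP ey; subst y2.
have y0 : y1 + y1 != 0.
  by apply/negP; rewrite addr_eq0 => /eqP e; apply: n; rewrite -e.
by apply: (mulIf y0); rewrite e2 f2.
Qed.

Lemma ec_addC_raw p q : on_ec p -> on_ec q -> add p q = add q p.
Proof.
case: p => [[x1 y1]|]; case: q => [[x2 y2]|] // hp hq.
case: (ec_addP hp hq) => [-> ->|l n hl _]; first by rewrite /= eqxx opprK eqxx.
rewrite (ec_add_line hq hp _ (ec_line_sym hl)).
  case: hl => e1 _; have -> : y2 = y1 - l * (x1 - x2) by rewrite -e1; ring.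
  by congr (Some (_, _)); ring.
by case=> e1 e2; apply: n; rewrite e1 e2 opprK.
Qed.

Lemma ec_addN_raw p : add (opp p) p = None.
Proof. by case: p => [[x y]|] //=; rewrite !eqxx. Qed.

Lemma ec_oppD_raw p q : on_ec p -> on_ec q -> opp (add p q) = add (opp p) (opp q).
Proof.
case: p => [[x1 y1]|]; case: q => [[x2 y2]|] // hp hq.
case: (ec_addP hp hq) => [-> ->|l n [e1 e2] _]; first by rewrite /= opprK !eqxx.
have hl : ec_line (- l) x1 (- y1) x2 (- y2).
  by split; [rewrite mulNr -e1; ring | rewrite -e2; ring].
rewrite [RHS](ec_add_line (ec_opp_on hp) (ec_opp_on hq) _ hl) /=.
  by congr (Some (_, _)); ring.
by case=> e3 e4; apply: n; rewrite e3 -[y1]opprK e4 opprK.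
Qed.

Lemma ec_add_neq x1 y1 x2 y2 : on_ec (Some (x1, y1)) -> on_ec (Some (x2, y2)) ->
  add (Some (x1, y1)) (Some (x2, y2)) <> Some (x2, y2).
Proof.
move=> h1 h2; case: ec_addP => // l n [e1 e2] _ [ex ey].
have t0 := ec_two_neq0.
have y1E : y1 = y2 + l * (x1 - x2) by rewrite -e1; ring.
have y20 : y2 = 0.
  apply: (mulfI t0); rewrite mulr0.
  by move: ey; rewrite ex y1E => e; rewrite mulr2n mulrDl mul1r -{1}e; ring.
have := @ec_nonsing x2; move: h2 => /= /eqP <-; rewrite y20 expr0n => /(_ erefl) /negP; apply.
have aE : a = l * (y1 + y2) - (x1 ^+ 2 + x1 * x2 + x2 ^+ 2) by rewrite e2; ring.
have x1E : x1 = l ^+ 2 - x2 - x2 by rewrite -{2}ex; ring.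
by rewrite aE y1E y20 x1E; apply/eqP; ring.
Qed.

Lemma ec_addK_raw p q : on_ec p -> on_ec q -> add (add p q) (opp q) = p.
Proof.
case: p => [[x1 y1]|]; case: q => [[x2 y2]|] // hp hq; last first.
  by rewrite /= opprK !eqxx.
have := ec_add_neq hp hq; have := ec_add_on hp hq.
case: (ec_addP hp hq) => [-> -> //|l n [e1 e2] _]; set xs := _ - _ - x2; set ys := _ - y1.
move=> hs nS.
have y1E : y1 = y2 + l * (x1 - x2) by rewrite -e1; ring.
have aE : a = l * (y1 + y2) - (x1 ^+ 2 + x1 * x2 + x2 ^+ 2) by rewrite e2; ring.
have hl : ec_line (- l) xs ys x2 (- y2).
  by split; rewrite ?aE /ys y1E /xs; ring.
have nS' : (xs, ys) <> (x2, - - y2) by rewrite opprK => e; apply: nS; rewrite e.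
rewrite [LHS](ec_add_line hs (ec_opp_on hq) nS' hl).
by congr (Some (_, _)); rewrite /ys ?y1E /xs; ring.
Qed.

Lemma ec_oppK_raw p : opp (opp p) = p.
Proof. by case: p => [[x y]|] //=; rewrite opprK. Qed.

Lemma ec_add_eq0 p q : on_ec p -> on_ec q -> add p q = None -> p = opp q.
Proof. by move=> hp hq e; rewrite -(ec_addK_raw hp hq) e. Qed.

Lemma ec_same_x x y y' : on_ec (Some (x, y)) -> on_ec (Some (x, y')) ->
  y = y' \/ y = - y'.
Proof.
move=> /= /eqP h1 /eqP h2; have /eqP : y ^+ 2 = y' ^+ 2 by rewrite h1 h2.
by rewrite eqf_sqr => /orP[] /eqP ->; [left|right].
Qed.

Lemma ec_same_x_raw x y q : on_ec (Some (x, y)) -> on_ec q ->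
  Some (x, y) <> q -> Some (x, y) <> opp q -> 
  if q is Some (x', _) then x - x' != 0 else true.
Proof.
case: q => [[x' y']|] //= h h' n n'; apply/eqP => /eqP; rewrite subr_eq0 => /eqP e; subst x'.
by case: (ec_same_x h h') => e; subst y.
Qed.

Lemma ec_assoc_gen p q r : on_ec p -> on_ec q -> on_ec r ->
  p <> r ->
  add p q <> r -> add p q <> opp r -> p <> add q r -> p <> opp (add q r) ->
  p <> None -> q <> None -> r <> None -> add p q <> None -> add q r <> None ->
  add (add p q) r = add p (add q r).
Proof.
case: p => [[x1 y1]|]; case: q => [[x2 y2]|] //; case: r => [[x3 y3]|] // hp hq hr.
have := ec_add_on hp hq; have := ec_add_on hq hr.
case: (ec_addP hp hq) => // l nl hl _; case: (ec_addP hq hr) => // m nm hm _.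
set xs := _ - _ - x2; set ys := _ - y1; set xt := _ - _ - x3; set yt := _ - y2.
move=> ht hs npr n1 n2 n3 n4 _ _ _ _ _.
have d1 : xs - x3 != 0 := ec_same_x_raw hs hr n1 n2.
have d2 : x1 - xt != 0 := ec_same_x_raw hp ht n3 n4.
have nlm : l != m.
  apply/eqP => e; subst m; case: hl hm => e1 e2 [f1 f2].
  have y1E : y1 = y2 + l * (x1 - x2) by rewrite -e1; ring.
  have y3E : y3 = y2 - l * (x2 - x3) by rewrite -f1; ring.
  have aE : a = l * (y1 + y2) - (x1 ^+ 2 + x1 * x2 + x2 ^+ 2) by rewrite e2; ring.
  have /eqP : (x1 - x3) * (xs - x3) = 0.
    move/eqP: f2; rewrite -subr_eq0 aE y1E y3E => /eqP f2.
    by rewrite -[RHS]oppr0 -f2 /xs; ring.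
  rewrite mulf_eq0 (negbTE d1) orbF subr_eq0 => /eqP e.
  by apply: npr; rewrite y1E y3E e; congr (Some (_, _)); ring.
have [ex ey] := ec_gen_x hl hm nlm d1 d2.
rewrite (ec_add_line hs hr _ (ec_line_chord hs hr d1)); last by case=> e; rewrite e subrr eqxx in d1.
rewrite (ec_add_line hp ht _ (ec_line_chord hp ht d2)); last by case=> e; rewrite e subrr eqxx in d2.
by congr (Some (_, _)).
Qed.

(* (C - B) + (B + C) = C + C, the degenerate case left out by ec_assoc_gen. *)
Lemma ec_dbl_chord x2 y2 x3 y3 : on_ec (Some (x2, y2)) -> on_ec (Some (x3, y3)) ->
  x3 - x2 != 0 -> y3 != 0 ->
  add (add (Some (x3, y3)) (Some (x2, - y2))) (add (Some (x2, y2)) (Some (x3, y3)))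
    <> None ->
  add (add (Some (x3, y3)) (Some (x2, - y2))) (add (Some (x2, y2)) (Some (x3, y3)))
  = add (Some (x3, y3)) (Some (x3, y3)).
Proof.
move=> h2 h3 nx ny; have t0 := ec_two_neq0.
have h2' := ec_opp_on h2; rewrite /= -/(on_ec (Some (x2, - y2))) in h2'.
rewrite (ec_addC_raw h2 h3).
have n32 z : (x3, y3) <> (x2, z) by case=> e; rewrite e subrr eqxx in nx.
have := ec_add_on h3 h2; have := ec_add_on h3 h2'.
have l1 := ec_line_chord h3 h2 nx; have l2 := ec_line_chord h3 h2' nx.
have aE : a = (y3 - y2) / (x3 - x2) * (y3 + y2) - (x3 ^+ 2 + x3 * x2 + x2 ^+ 2).
  by case: l1 => _ ->; ring.
rewrite (ec_add_line h3 h2 (n32 _) l1) (ec_add_line h3 h2' (n32 _) l2).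
have nd : (x3, y3) <> (x3, - y3).
  case=> /eqP; rewrite -addr_eq0 -mulr2n -mulr_natl mulf_eq0 (negbTE t0).
  by rewrite (negbTE ny).
rewrite (ec_add_line h3 h3 nd (ec_line_tangent x3 ny)).
set p := (y3 - y2) / _; set q := (y3 - - y2) / _.
set xa := _ - _ - _; set ya := _ - y3; set xt := p ^+ 2 - _ - _; set yt := _ - y3 => ha ht nN.
have [y20|y20] := eqVneq y2 0.
{
  have eqp : q = p by rewrite /q /p y20 !oppr0.
  have ex : xa = xt by rewrite /xa /xt eqp.
  have ey : ya = yt by rewrite /ya /yt ex eqp.
  rewrite ex ey in nN *.
  have yt0 : yt != 0.
    by apply/eqP => e; apply: nN; rewrite /= e oppr0 !eqxx.
  have ndt : (xt, yt) <> (xt, - yt).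
    case=> /eqP; rewrite -addr_eq0 -mulr2n -mulr_natl mulf_eq0 (negbTE t0).
    by rewrite (negbTE yt0).
  rewrite (ec_add_line ht ht ndt (ec_line_tangent xt yt0)).
  move: yt0; rewrite /yt /xt /p aE y20 => yt0.
  have K := mulf_neq0 yt0 (expf_neq0 3 nx).
  congr (Some (_, _)); field; rewrite ?t0 ?ny ?nx ?yt0 //=.
  all: by apply: contra K => /eqP K; apply/eqP; rewrite -[RHS]K; field.
}
have dx : xa - xt != 0.
  have -> : xa - xt = 2%:R * 2%:R * y2 * y3 / (x3 - x2) ^+ 2.
    by rewrite /xa /xt /p /q; field.
  by rewrite !mulf_neq0 ?invr_neq0 ?expf_neq0.
rewrite (ec_add_line ha ht _ (ec_line_chord ha ht dx)); last by case=> e; rewrite e subrr eqxx in dx.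
move: dx; rewrite /ya /yt /xa /xt /p /q aE => dx.
have K := mulf_neq0 dx (expf_neq0 2 nx).
congr (Some (_, _)); field; rewrite ?t0 ?ny ?nx ?y20 ?dx //=.
all: by apply: contra K => /eqP K; apply/eqP; rewrite -[RHS]K; field.
Qed.

Lemma ec_dbl_raw q r : on_ec q -> on_ec r -> q <> None -> r <> None ->
  r <> q -> r <> opp q -> r <> opp r ->
  add (add r (opp q)) (add q r) <> None ->
  add (add r (opp q)) (add q r) = add r r.
Proof.
case: q r => [[x2 y2]|] // [[x3 y3]|] // hq hr _ _ n1 n2 n3.
apply: ec_dbl_chord => //; first exact: ec_same_x_raw hr hq n1 n2.
by apply/eqP => e; apply: n3; rewrite e /= oppr0.
Qed.

Lemma ec_addA_raw p q r : on_ec p -> on_ec q -> on_ec r ->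
  add p (add q r) = add (add p q) r.
Proof.
move=> hp hq hr; apply/esym.
have hpq := ec_add_on hp hq; have hqr := ec_add_on hq hr.
have hN := ec_opp_on.
have add0r t : add None t = t by [].
have addr0 t : add t None = t by case: t => [[]|].
have [->|/eqP p0] := eqVneq p None; first by rewrite !add0r.
have [->|/eqP q0] := eqVneq q None; first by rewrite addr0 add0r.
have [->|/eqP r0] := eqVneq r None; first by rewrite !addr0.
have [e|/eqP pq0] := eqVneq (add p q) None.
  rewrite e add0r (ec_add_eq0 hp hq e) ec_addC_raw ?hN // (ec_addC_raw hq hr).
  by rewrite ec_addK_raw.
have [e|/eqP qr0] := eqVneq (add q r) None.
  rewrite e addr0 -[in RHS](ec_addK_raw hp hq) (ec_add_eq0 hq hr e).
  by rewrite ec_oppK_raw.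
have [->|/eqP pr] := eqVneq p r.
  by rewrite (ec_addC_raw hr hq) ec_addC_raw ?ec_add_on.
have [e|/eqP n2] := eqVneq (add p q) (opp r).
  have -> : add q r = opp p.
    rewrite -[r]ec_oppK_raw -e -[q]ec_oppK_raw -ec_oppD_raw ?ec_add_on ?hN //.
    by rewrite ec_oppK_raw ec_addC_raw ?hN // ec_addK_raw.
  by rewrite e ec_addN_raw ec_addC_raw ?hN // ec_addN_raw.
have [e|/eqP n4] := eqVneq p (opp (add q r)).
  have -> : add p q = opp r.
    rewrite e -{2}[q]ec_oppK_raw -ec_oppD_raw ?hN //.
    by rewrite (ec_addC_raw hq hr) ec_addK_raw.
  by rewrite ec_addN_raw e ec_addN_raw.
have [e|/eqP n1] := eqVneq (add p q) r.
  have pE : p = add r (opp q) by rewrite -e ec_addK_raw.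
  rewrite e pE ec_dbl_raw //.
  - by move=> erq; apply: p0; rewrite pE erq ec_addC_raw ?hN // ec_addN_raw.
  - by move=> erq; apply: qr0; rewrite erq ec_addC_raw ?hN // ec_addN_raw.
  - by rewrite -{1}e.
  - by rewrite -pE => /ec_add_eq0 -/(_ hp hqr).
have [e|/eqP n3] := eqVneq p (add q r).
  have rE : r = add p (opp q) by rewrite e (ec_addC_raw hq hr) ec_addK_raw.
  rewrite -e (ec_addC_raw hp hq) ec_addC_raw ?ec_add_on // {1}rE ec_dbl_raw //.
  - by move=> epq; apply: r0; rewrite rE epq ec_addC_raw ?hN // ec_addN_raw.
  - by move=> epq; apply: pq0; rewrite epq ec_addN_raw.
  - by rewrite {2}e.
  - rewrite -rE ec_addC_raw ?ec_add_on // (ec_addC_raw hq hp).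
    by move=> /ec_add_eq0 -/(_ hpq hr).
exact: ec_assoc_gen.
Qed.

Record ecpoint := ECPoint { ec_coords :> option (F * F); _ : on_ec ec_coords }.
HB.instance Definition _ := [isSub for ec_coords].
HB.instance Definition _ := [Choice of ecpoint by <:].

Definition ec_zero : ecpoint := @ECPoint None isT.
Definition ec_opp (p : ecpoint) : ecpoint := ECPoint (ec_opp_on (valP p)).
Definition ec_add (p q : ecpoint) : ecpoint := ECPoint (ec_add_on (valP p) (valP q)).

Fact ec_addA : associative ec_add.
Proof. by move=> p q r; apply: val_inj; rewrite /= ec_addA_raw ?(valP p, valP q, valP r). Qed.
Fact ec_addC : commutative ec_add.
Proof. by move=> p q; apply: val_inj; rewrite /= ec_addC_raw ?(valP p, valP q). Qed.
Fact ec_add0 : left_id ec_zero ec_add.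
Proof. by move=> p; apply: val_inj. Qed.
Fact ec_addN : left_inverse ec_zero ec_opp ec_add.
Proof. by move=> p; apply: val_inj; rewrite /= ec_addN_raw. Qed.

HB.instance Definition _ :=
  GRing.isZmodule.Build ecpoint ec_addA ec_addC ec_add0 ec_addN.

End Raw.

Definition ec_fraction (p : option (rat * rat)) (m n e : int) : Prop :=
  [/\ 1 <= e, coprimez m e, coprimez n e &
      p = Some (m%:Q / e%:Q ^+ 2, n%:Q / e%:Q ^+ 3)].

Definition pow2_fractions (E : ecurve rat) (P : ecpoint E)
  (m n e : nat -> int) : Prop :=
  forall k, ec_fraction (P *+ (2 ^ k)) (m k) (n k) (e k).

(* e 0 and the quotients e k / e (k-1); by ecF_mul the Euclidean quotient is exact
   for the denominators of the multiples 2^k P considered here. *)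
Definition ecF (e : nat -> int) (k : nat) : int :=
  if k is j.+1 then (e k %/ e j)%Z else e 0%N.

Fact ecE_disc : - 16%:R * (4%:R * (- 2%:R) ^+ 3 + 27%:R * 0 ^+ 2) != 0 :> rat.
Proof. by []. Qed.
Definition ecE : ecurve rat := @ECurve rat (- 2%:R) 0 ecE_disc.

Fact ecP_on : on_ec ecE (Some (2%:R, 2%:R)).
Proof. by []. Qed.
Definition ecP : ecpoint ecE := @ECPoint rat ecE (Some (2%:R, 2%:R)) ecP_on.

Lemma ecE_double (Q : ecpoint ecE) x y : ec_coords Q = Some (x, y) -> y != 0 ->
  exists z, ec_coords (Q + Q) = Some ((x ^+ 2 + 2%:R) ^+ 2 / (4%:R * y ^+ 2), z).
Proof.
move=> hQ y0; have h := valP Q; rewrite /= hQ in h.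
rewrite /= hQ (@ec_add_line _ ecE ((3%:R * x ^+ 2 + ec_a ecE) / (2%:R * y))) //; first last.
- exact: ec_line_tangent.
- by case=> /eqP; rewrite -addr_eq0 -mulr2n mulrn_eq0 (negbTE y0).
eexists; congr (Some (_, _)).
move: h => /= /eqP h.
have -> : ((3%:R * x ^+ 2 - 2%:R) / (2%:R * y)) ^+ 2 - x - x =
  ((3%:R * x ^+ 2 - 2%:R) ^+ 2 - 8%:R * x * y ^+ 2) / (4%:R * y ^+ 2) by field.
by congr (_ / _); rewrite h; ring.
Qed.

Lemma ecE_double0 (Q : ecpoint ecE) x : ec_coords Q = Some (x, 0) -> Q + Q = 0.
Proof. by move=> hQ; apply: val_inj; rewrite /= hQ /= oppr0 !eqxx. Qed.

Lemma ec_fraction_ex (Q : ecpoint ecE) x y : ec_coords Q = Some (x, y) ->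
  exists m n e, ec_fraction Q m n e.
Proof.
move=> hQ; have h := valP Q; rewrite /= hQ /= addr0 in h; move/eqP: h => h.
pose c := numq x; pose d := denq x; pose c' := numq y; pose d' := denq y.
have d0 : d%:Q != 0 by rewrite intr_eq0 denq_neq0.
have d0' : d'%:Q != 0 by rewrite intr_eq0 denq_neq0.
have xE : x = c%:Q / d%:Q by rewrite divq_num_den.
have yE : y = c'%:Q / d'%:Q by rewrite divq_num_den.
have H : c' ^+ 2 * d ^+ 3 = (c ^+ 3 - 2%:R * c * d ^+ 2) * d' ^+ 2.
  apply: (@intr_inj rat); rewrite !(rmorphM, rmorphXn, rmorphB) /=.
  have -> : c%:Q = x * d%:Q by rewrite xE mulfVK.
  have -> : c'%:Q = y * d'%:Q by rewrite yE mulfVK.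
  by rewrite exprMn h; ring.
have ccd : coprimez c d := coprime_num_den x.
have ccd' : coprimez c' d' := coprime_num_den y.
have D1 : (d' ^+ 2 %| d ^+ 3)%Z.
  rewrite -(@Gauss_dvdzr _ (c' ^+ 2)); last first.
    by rewrite coprimez_sym coprimez_pexpl // coprimez_pexpr.
  by rewrite H dvdz_mull.
have D2 : (d ^+ 3 %| d' ^+ 2)%Z.
  rewrite -(@Gauss_dvdzr _ (c ^+ 3 - 2%:R * c * d ^+ 2)); first by rewrite -H dvdz_mull.
  rewrite coprimez_pexpl // /coprimez addrC.
  have -> : - (2%:R * c * d ^+ 2) + c ^+ 3 = (- (2%:R * c * d)) * d + c ^+ 3 by ring.
  by rewrite gcdzMDl -/(coprimez _ _) coprimez_pexpr // coprimez_sym.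
have dp : 0 < d := denq_gt0 x; have dp' : 0 < d' := denq_gt0 y.
have D : d' ^+ 2 = d ^+ 3.
  have : (`|d' ^+ 2| == `|d ^+ 3|)%N by rewrite eqn_dvd; apply/andP.
  by rewrite -eqz_nat !gez0_abs ?exprn_ge0 ?ltW // => /eqP.
have /dvdzP[e eE] : (d %| d')%Z.
  by rewrite -(@dvdz_pexp2r _ _ 2) // D exprS dvdz_mull.
have dn0 : d != 0 by rewrite gt_eqF.
have dE : d = e ^+ 2.
  apply: (mulIf (expf_neq0 2 dn0)).
  by rewrite -exprS -D eE exprMn.
have ep : 0 < e by move: dp'; rewrite eE pmulr_lgt0.
have dE' : d' = e ^+ 3 by rewrite eE dE; ring.
exists c, c', e; split.
- by rewrite -gtz0_ge1.
- by move: ccd; rewrite dE coprimez_pexpr.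
- by move: ccd'; rewrite dE' coprimez_pexpr.
- by rewrite hQ xE yE dE dE' !rmorphXn.
Qed.

Lemma frac_coprime (m e : int) : coprimez m e -> coprimez e (m ^+ 2 + 2%:R * e ^+ 4).
Proof.
move=> h; rewrite /coprimez addrC.
have -> : 2%:R * e ^+ 4 = (2%:R * e ^+ 3) * e by ring.
by rewrite gcdzMDl -/(coprimez _ _) coprimez_pexpr // coprimez_sym.
Qed.

Lemma double_fraction (Q : ecpoint ecE) m n e m' n' e' :
  ec_fraction Q m n e -> ec_fraction (Q + Q) m' n' e' ->
  4%:R * m' * n ^+ 2 * e ^+ 2 = e' ^+ 2 * (m ^+ 2 + 2%:R * e ^+ 4) ^+ 2.
Proof.
move=> [e1 _ _ hQ] [e1' _ _ hQ'].
have e0 : e%:Q != 0 by rewrite intr_eq0 gt_eqF // gtz0_ge1.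
have e0' : e'%:Q != 0 by rewrite intr_eq0 gt_eqF // gtz0_ge1.
have [n0|n0] := eqVneq n 0.
  by move: hQ hQ'; rewrite n0 mul0r => /ecE_double0 ->.
have n0' : n%:Q != 0 by rewrite intr_eq0.
have y0 : n%:Q / e%:Q ^+ 3 != 0 by rewrite mulf_neq0 ?invr_neq0 ?expf_neq0.
have [z] := ecE_double hQ y0; rewrite hQ' => -[hx _].
apply: (@intr_inj rat); rewrite !(rmorphM, rmorphXn, rmorphD) /=.
have -> : m'%:Q = m'%:Q / e'%:Q ^+ 2 * e'%:Q ^+ 2 by field.
rewrite hx; field.
by rewrite n0' e0.
Qed.

Lemma dvd_denominators m n e : pow2_fractions ecP m n e -> forall k, (e k %| e k.+1)%Z.
Proof.
move=> h k; have := h k.+1; rewrite expnS mulnC mulrnA mulr2n => h'.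
have := double_fraction (h k) h'; case: (h k) => _ /frac_coprime cp _ _ H.
rewrite -(@dvdz_pexp2r _ _ 2) // -(@Gauss_dvdzl _ _ ((m k ^+ 2 + 2%:R * e k ^+ 4) ^+ 2)).
  by rewrite -H dvdz_mull.
by rewrite coprimez_pexpl // coprimez_pexpr.
Qed.

Lemma ecF_mul m n e : pow2_fractions ecP m n e ->
  forall k, ecF e k.+1 * e k = e k.+1.
Proof. by move=> h k; rewrite /= divzK // (dvd_denominators h). Qed.

(* In particular 2^k P is never the point at infinity. *)
Lemma ecP_fraction_ex k : exists m n e, ec_fraction (ecP *+ 2 ^ k) m n e.
Proof.
have odd_frac (Q : ecpoint ecE) m n e : ec_fraction Q m n e -> (2 %| e)%Z ->
   exists m' n' e', ec_fraction (Q + Q) m' n' e' /\ (2 %| e')%Z.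
  move=> hQ e2; case: (hQ) => e1 cm cn hv.
  have n0 : n != 0.
    apply/eqP => n0; move: cn; rewrite n0 coprimezE /coprime gcd0n => /eqP H.
    by move: e2; rewrite dvdzE H.
  have e0 : e%:Q != 0 by rewrite intr_eq0 gt_eqF // gtz0_ge1.
  have y0 : n%:Q / e%:Q ^+ 3 != 0.
    by rewrite mulf_neq0 ?invr_neq0 ?expf_neq0 // intr_eq0.
  have [z /ec_fraction_ex [m' [n' [e' h']]]] := ecE_double hv y0.
  exists m', n', e'; split=> //.
  have H := double_fraction hQ h'.
  have c2 : coprimez 2 (m ^+ 2 + 2%:R * e ^+ 4).
    exact: coprimez_dvdl e2 (frac_coprime cm).
  have : (2 %| e' ^+ 2 * (m ^+ 2 + 2%:R * e ^+ 4) ^+ 2)%Z.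
    by rewrite -H -!mulrA dvdz_mulr.
  rewrite Gauss_dvdzl; last by rewrite coprimez_pexpr.
  by rewrite !dvdzE abszX Euclid_dvdX // andbT.
have hP j : exists m n e, ec_fraction (ecP *+ 2 ^ j.+1) m n e /\ (2 %| e)%Z.
  elim: j => [|j [m [n [e [h h2]]]]]; last first.
    by rewrite expnS mulnC mulrnA mulr2n; apply: odd_frac h h2.
  exists 9, (- 21), 2; split=> //; split=> //.
case: k => [|k]; last by have [m [n [e []]]] := hP k; exists m, n, e.
by exists 2, 2, 1; split.
Qed.

Lemma pow2_fractions_ex : exists m n e, pow2_fractions ecP m n e.
Proof.
pose b k (t : int * int * int) := [&& 1 <= t.2, coprimez t.1.1 t.2, coprimez t.1.2 t.2 &
  ec_coords (ecP *+ 2 ^ k)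
  == Some (t.1.1%:Q / t.2%:Q ^+ 2, t.1.2%:Q / t.2%:Q ^+ 3)].
have ex k : exists t, b k t.
  have [m [n [e [h1 h2 h3 h4]]]] := ecP_fraction_ex k.
  by exists (m, n, e); rewrite /b /= h1 h2 h3 h4 eqxx.
exists (fun k => (xchoose (ex k)).1.1), (fun k => (xchoose (ex k)).1.2),
  (fun k => (xchoose (ex k)).2) => k.
by case/and4P: (xchooseP (ex k)) => h1 h2 h3 /eqP h4; split.
Qed.

(* Main.v *)
From HB Require Import structures.
Require Import Defs.
From mathcomp Require Import all_boot all_order all_algebra all_fingroup.
From mathcomp Require Import all_solvable all_field ring zify.
Set Implicit Arguments. Unset Strict Implicit. Unset Printing Implicit Defensive.
Import Order.TTheory GRing.Theory Num.Theory FinRing.Theory.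
Local Open Scope group_scope.
Local Open Scope ring_scope.

(* If an odd prime [p] divides [F_k] with [k >= 1], then [P] reduces modulo [p]
   to a point of order exactly [2^k], and [#E(F_p) = p + 1 + S] where
   [S = sum_x chi(x^3 - 2x)] for the quadratic character [chi].

   If [p = -1 mod 4], then [S = 0] because [chi] is odd, so Lagrange's theorem
   gives [2^k | p + 1].

   If [p = 1 mod 4], then [E(F_p)] is a module over [Z[i]]. As [(1 + i)^2 = 2i],
   the point is not killed by [(1 + i)^(2k-2)], so the kernels of the powers of
   [1 + i] show that [2^(2k-1) | #E(F_p)]. Jacobsthal's identity
   gives [p = a^2 + b^2] with [S = -2a], so [2^(2k-1)] divides
   [#E(F_p) = (a - 1)^2 + b^2]. Hence [2^(k-1) | a - 1] and [2^k] divides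
   [p - 1 = #E(F_p) + 2(a - 1)]. *)

(** * Quadratic character of a finite field and Jacobsthal sums *)

Section QuadraticCharacter.
Variable F : finFieldType.
Hypothesis two_neq0 : 2%:R != 0 :> F.

(** Counting square roots yields the quadratic character and makes its sums point counts. *)
Definition qchar (x : F) : int := #|[set y : F | y ^+ 2 == x]|%:Z - 1.

Lemma qchar0 : qchar 0 = 0.
Proof.
rewrite /qchar (_ : [set y | _] = [set 0]) ?cards1 //.
by apply/setP => y; rewrite !inE expf_eq0.
Qed.

Lemma neq_opp (t : F) : t != 0 -> t != - t.
Proof. by move=> t0; rewrite -addr_eq0 -mulr2n -mulr_natl mulf_neq0. Qed.

Lemma qchar_sqr t : t != 0 -> qchar (t ^+ 2) = 1.
Proof.
move=> t0; rewrite /qchar (_ : [set y | _] = [set t; - t]).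
  by rewrite cards2 neq_opp.
by apply/setP => y; rewrite !inE eqf_sqr.
Qed.

Lemma qchar_nonsqr x : (forall y, y ^+ 2 != x) -> qchar x = - 1.
Proof.
move=> h; rewrite /qchar (_ : [set y | _] = set0) ?cards0 //.
by apply/setP => y; rewrite !inE (negbTE (h y)).
Qed.

Variant qchar_spec (x : F) : int -> Type :=
| QChar0 of x = 0 : qchar_spec x 0
| QCharSqr (t : F) of t != 0 & x = t ^+ 2 : qchar_spec x 1
| QCharNonsqr of x != 0 & (forall y, y ^+ 2 != x) : qchar_spec x (- 1).

Lemma qcharP x : qchar_spec x (qchar x).
Proof.
have [->|x0] := eqVneq x 0; first by rewrite qchar0; apply: QChar0.
case: (pickP [pred y : F | y ^+ 2 == x]) => [t /= /eqP tx|h].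
  have t0 : t != 0 by apply: contra x0 => /eqP t0; rewrite -tx t0 expr0n.
  by rewrite -tx qchar_sqr //; apply: QCharSqr t0 _.
have h' y : y ^+ 2 != x by rewrite -[_ == _]/([pred y : F | y ^+ 2 == x] y) h.
by rewrite qchar_nonsqr //; apply: QCharNonsqr.
Qed.

Lemma qchar_sqr_id x : x != 0 -> qchar x ^+ 2 = 1.
Proof. by case: qcharP => // ->; rewrite eqxx. Qed.

Lemma qcharM_sqr x t : t != 0 -> qchar (x * t ^+ 2) = qchar x.
Proof.
move=> t0; congr (_%:Z - 1).
rewrite -[RHS](card_imset _ (mulIf t0)); apply/eq_card => y; rewrite !inE.
apply/eqP/imsetP => [yx|[z]]; last by rewrite inE => /eqP <- ->; rewrite exprMn.
exists (y / t); last by rewrite mulfVK.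
by rewrite inE exprMn yx exprVn mulfK // expf_neq0.
Qed.

(** The fibres of squaring partition [F], so the root counts add up to [#|F|]. *)
Lemma sum_qchar : \sum_x qchar x = 0.
Proof.
rewrite /qchar sumrB sumr_const -raddf_sum /=.
suff -> : (\sum_(x : F) #|[set y : F | y ^+ 2 == x]|)%N = #|F| by rewrite -natz subrr.
rewrite -sum1_card [RHS](partition_big (fun y : F => y ^+ 2) predT) //=.
by apply: eq_bigr => x _; rewrite -sum1_card; apply: eq_bigl => y; rewrite inE.
Qed.

(* If [a] is not a square, the terms [qchar (a * x) + qchar x] are nonpositive
   and add up to zero, so all of them vanish. *)
Lemma qcharM x y : qchar (x * y) = qchar x * qchar y.
Proof.
case: (qcharP x) => [->|t t0 ->|a0 ha]; first by rewrite mul0r qchar0 mul0r.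
  by rewrite mulrC qcharM_sqr // mul1r.
rewrite mulN1r; apply/eqP; rewrite -addr_eq0 -oppr_eq0; apply/eqP.
have qa : qchar x = -1 by exact: qchar_nonsqr.
have ge0 z : 0 <= - (qchar (x * z) + qchar z).
  case: (qcharP z) => [->|t t0 ->|z0 hz]; first by rewrite mulr0 qchar0.
    by rewrite qcharM_sqr // qa.
  by case: qcharP.
have /eqP : \sum_z - (qchar (x * z) + qchar z) = 0.
  rewrite sumrN big_split /= sum_qchar addr0.
  by have := sum_qchar; rewrite (reindex_inj (mulfI a0)) /= => ->; rewrite oppr0.
by rewrite psumr_eq0 // => /allP /(_ y); rewrite mem_index_enum => /(_ isT) /eqP.
Qed.

(** Orthogonality of translates. For [u != v], a shift of [d] gives [qchar (d * (d + c))], which is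
    [qchar (1 + c / d)] for [d != 0]. *)
Lemma sum_qchar_pair u v :
  \sum_d qchar (u - d) * qchar (v - d) = (u == v)%:R * #|F|%:R - 1.
Proof.
have [<-|uv] := eqVneq u v.
  rewrite mul1r (reindex_inj (inv_inj (fun d => subKr u d))) /=.
  rewrite (bigD1 0) //= subKr qchar0 mul0r add0r.
  under eq_bigr => d d0 do rewrite subKr -expr2 qchar_sqr_id //.
  rewrite sumr_const cardC1; have: (0 < #|F|)%N by apply/card_gt0P; exists 0.
  by case: #|F| => // n _; rewrite -[in RHS]natr1 addrK.
rewrite mul0r add0r (reindex_inj (inv_inj (fun d => subKr u d))) /=.
rewrite (bigD1 0) //= subKr qchar0 mul0r add0r.
set c := v - u; have c0 : c != 0 by rewrite subr_eq0 eq_sym.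
transitivity (\sum_(d | d != 0) qchar (1 + c * d^-1)).
  apply: eq_bigr => d d0; rewrite subKr -qcharM.
  rewrite -[RHS](@qcharM_sqr _ d) //; congr qchar.
  by rewrite /c; field.
rewrite (reindex_inj invr_inj) /=.
under eq_bigl => d do rewrite invr_eq0.
under eq_bigr => d _ do rewrite invrK.
(* The missing term at [d = 0] is 1; with it the sum runs over all of [F] and vanishes. *)
apply: (addrI (qchar (1 + c * 0))).
rewrite -(bigD1 (P := predT) (F := fun d => qchar (1 + c * d)) 0) //=.
rewrite mulr0 addr0 -[X in qchar X](expr1n _ 2) qchar_sqr ?oner_neq0 // subrr.
rewrite -[RHS]sum_qchar [RHS](reindex_inj (addrI 1)) /=.
by rewrite [RHS](reindex_inj (mulfI c0)).
Qed.

(** The sum of [qchar (x ^+ 3 - d * x)], factored to suit [sum_qchar_pair]. *)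
Definition jacobsthal (d : F) : int := \sum_x qchar x * qchar (x ^+ 2 - d).

Lemma jacobsthal0 : jacobsthal 0 = 0.
Proof.
rewrite -[RHS]sum_qchar; apply: eq_bigr => x _; rewrite subr0.
have [->|x0] := eqVneq x 0; first by rewrite qchar0 mul0r.
by rewrite qchar_sqr // mulr1.
Qed.

Lemma jacobsthalM_sqr d t : t != 0 ->
  jacobsthal (d * t ^+ 2) = qchar t * jacobsthal d.
Proof.
move=> t0; rewrite /jacobsthal (reindex_inj (mulfI t0)) mulr_sumr /=.
apply: eq_bigr => x _; rewrite qcharM mulrA; congr (_ * _).
by rewrite -[RHS](qcharM_sqr _ t0); congr qchar; ring.
Qed.

(** Substituting [- x] for [x]; this kills the sum when [qchar (- 1) = - 1]. *)
Lemma jacobsthal_opp d : jacobsthal d = qchar (- 1) * jacobsthal d.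
Proof.
by rewrite -jacobsthalM_sqr ?oppr_eq0 ?oner_neq0 // sqrrN expr1n mulr1.
Qed.

(** Expand the square and sum over [d] first: orthogonality leaves [y = x] and [y = - x], which
    contribute equally as [qchar (- 1) = 1]. *)
Lemma sum_jacobsthal_sqr : qchar (- 1) = 1 ->
  \sum_d jacobsthal d ^+ 2 = 2%:R * #|F|%:R * (#|F|%:R - 1).
Proof.
move=> qN1.
transitivity (\sum_x \sum_y qchar x * qchar y * ((x ^+ 2 == y ^+ 2)%:R * #|F|%:R - 1)).
  under eq_bigr => d _ do rewrite expr2 /jacobsthal mulr_suml.
  rewrite exchange_big /=; apply: eq_bigr => x _.
  under eq_bigr => d _ do rewrite mulr_sumr.
  rewrite exchange_big /=; apply: eq_bigr => y _.
  by rewrite -sum_qchar_pair mulr_sumr; apply: eq_bigr => d _; rewrite mulrACA.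
transitivity (\sum_(x : F | x != 0) 2%:R * #|F|%:R : int); last first.
  rewrite sumr_const cardC1 -[LHS]mulr_natr; congr (_ * _).
  have: (0 < #|F|)%N by apply/card_gt0P; exists 0.
  by case: #|F| => // n _; rewrite -natr1 addrK.
rewrite (bigD1 0) //= big1 ?add0r => [|y _]; last by rewrite qchar0 !mul0r.
apply: eq_bigr => x x0.
under eq_bigr => y _ do rewrite mulrBr mulr1.
rewrite sumrB -mulr_sumr sum_qchar mulr0 subr0.
rewrite (bigD1 x) //= (bigD1 (- x)) /=; last by rewrite eq_sym neq_opp.
rewrite sqrrN eqxx big1 ?addr0 => [|y /andP[yx yNx]]; last first.
  by rewrite eqf_sqr eq_sym (negbTE yx) -eqr_oppLR eq_sym (negbTE yNx) mul0r mulr0.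
by rewrite -[- x]mulN1r qcharM qN1 mul1r -expr2 qchar_sqr_id // !mul1r mulr_natl mulr2n.
Qed.

(** The squared sum depends only on the class of [d] modulo squares, so the second moment gives
    [J(1)^2 + J(a)^2 = 4 q] for a nonsquare [a]. *)
Lemma jacobsthal_two_squares (d : F) : d != 0 -> qchar (- 1) = 1 ->
  exists b : int, jacobsthal d ^+ 2 + b ^+ 2 = 4%:R * #|F|%:R.
Proof.
move=> d0 qN1.
have Jsq (c t : F) : t != 0 -> jacobsthal (c * t ^+ 2) ^+ 2 = jacobsthal c ^+ 2.
  by move=> t0; rewrite jacobsthalM_sqr // exprMn qchar_sqr_id // mul1r.
have [a aN] : exists a : F, forall y, y ^+ 2 != a.
  case: (pickP [pred a : F | qchar a == -1]) => [a /= /eqP qa|h].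
    exists a; move: qa; case: qcharP => //.
  have /eqP := sum_qchar; rewrite psumr_eq0.
    move=> /allP /(_ 1); rewrite mem_index_enum => /(_ isT).
    by rewrite -[1](expr1n _ 2) /= qchar_sqr ?oner_neq0.
  by move=> x _; move: (h x) => /=; case: qcharP.
have a0 : a != 0 by apply: contraTneq (aN 0) => ->; rewrite expr0n eqxx.
have qa : qchar a = -1 by exact: qchar_nonsqr.
(* The weights [1 + qchar c] and [1 - qchar c] select the class of [c]; as [qchar] sums to zero,
   both classes weigh the same. *)
have JE (c : F) : c != 0 -> 2%:R * jacobsthal c ^+ 2 =
    (1 + qchar c) * jacobsthal 1 ^+ 2 + (1 - qchar c) * jacobsthal a ^+ 2.
  case: (qcharP c) => [->|t t0 -> _|c0 cN _]; first by rewrite eqxx.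
    by rewrite -[t ^+ 2]mul1r Jsq //; ring.
  have : qchar (c / a) = 1.
    by rewrite qcharM -(qcharM_sqr a^-1 a0) expr2 mulKf // qa qchar_nonsqr.
  case: qcharP => // t t0 /(congr1 (fun z => a * z)); rewrite mulrC mulfVK // => -> _.
  by rewrite Jsq //; ring.
have H : jacobsthal 1 ^+ 2 + jacobsthal a ^+ 2 = 4%:R * #|F|%:R.
  have := sum_jacobsthal_sqr qN1.
  rewrite (bigD1 0) //= jacobsthal0 expr0n add0r => /(congr1 (fun z => 2%:R * z)).
  rewrite mulr_sumr (eq_bigr _ JE) big_split /= -!mulr_suml sumrB big_split /=.
  have -> : \sum_(i : F | i != 0) qchar i = 0.
    by rewrite -[RHS]sum_qchar [RHS](bigD1 0) //= qchar0 add0r.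
  rewrite sumr_const cardC1.
  have: (1 < #|F|)%N by apply/card_gt1P; exists 0, 1; rewrite eq_sym oner_neq0.
  case: #|F| => [//|[//|q]] _ /=.
  rewrite ?addr0 ?subr0 -[X in _ = _ * (_ * (X - 1))]natr1 addrK => E.
  have q0 : q.+1%:R != 0 :> int by rewrite pnatr_eq0.
  by apply: (mulfI q0); rewrite mulrDr E; ring.
have := JE d d0; case: (qcharP d) => [dE|t _ _|_ _] E; first by rewrite dE eqxx in d0.
  exists (jacobsthal a); rewrite -H; congr (_ + _).
  have t0 : 2%:R != 0 :> int by []. 
  by apply: (mulfI t0); rewrite E; ring.
exists (jacobsthal 1); rewrite -H addrC; congr (_ + _).
have t0 : 2%:R != 0 :> int by []. 
by apply: (mulfI t0); rewrite E; ring.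
Qed.

End QuadraticCharacter.

(** * Powers of 2 dividing the order of a finite abelian group *)

Section FiniteTorsion.
Variable V : finZmodType.

Lemma dvdn_card_order (v : V) n : v *+ 2 ^ n = 0 -> v *+ 2 ^ n.-1 != 0 ->
  (2 ^ n %| #|V|)%N.
Proof.
move=> v0 vn0; suff <- : #[v]%g = (2 ^ n)%N by rewrite -cardsT order_dvdG ?inE.
have : (#[v]%g %| 2 ^ n)%N by rewrite order_dvdn zmodXgE v0.
case/(dvdn_pfactor _ _ (isT : prime 2)) => j jn oj; rewrite oj; congr (2 ^ _)%N.
apply/eqP; rewrite eqn_leq jn /=; apply: contraR vn0; rewrite -ltnNge => jn'.
by rewrite -zmodXgE -order_dvdn oj dvdn_exp2l //; case: n jn' {jn v0}.
Qed.

Variable f : V -> V.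
Hypothesis fD : {morph f : u v / u + v}.
Hypothesis f2 : forall v, f v = 0 -> v *+ 2 = 0.

Let f0 : f 0 = 0.
Proof. by apply: (addrI (f 0)); rewrite -fD !addr0. Qed.

Let fiterD j : {morph iter j f : u v / u + v}.
Proof. by move=> u v; elim: j => //= j ->. Qed.

Let fiter0 j : iter j f 0 = 0.
Proof. by elim: j => //= j ->. Qed.

Definition iter_ker j := [set v | iter j f v == 0].

Lemma group_set_iter_ker j : group_set (iter_ker j).
Proof.
apply/group_setP; split=> [|u v]; rewrite !inE ?fiter0 //.
by move=> /eqP u0 /eqP v0; rewrite zmodMgE fiterD u0 v0 addr0.
Qed.
Canonical iter_ker_group j := Group (group_set_iter_ker j).

Lemma iter_kerS j : iter_ker j \subset iter_ker j.+1.
Proof. by apply/subsetP => v; rewrite !inE /= => /eqP ->; rewrite f0. Qed.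

(** An element killed by [f^j] is killed by [2^j], so by Cauchy's theorem 2 is the only possible
    prime factor of the order. *)
Lemma iter_ker_pgroup j : 2%N.-group (iter_ker j).
Proof.
have tor v : iter j f v = 0 -> v *+ 2 ^ j = 0.
  elim: j v => [|j IH] v //=; rewrite -iterS iterSr => /IH.
  have fMn w i : f w *+ i = f (w *+ i).
    by elim: i => [|i IHi]; rewrite ?mulr0n ?f0 // !mulrS fD IHi.
  by rewrite fMn => /f2; rewrite -mulrnA -expnSr.
apply/pgroupP => q pq /Cauchy -/(_ pq) [v]; rewrite inE => /eqP /tor v0 ov.
have : (q %| 2 ^ j)%N by rewrite -ov order_dvdn zmodXgE v0.
by rewrite Euclid_dvdX // => /andP[]; rewrite dvdn_prime2 // => /eqP ->.
Qed.

(** The kernels grow strictly up to level [j], and each index is a power of 2, hence even. *)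
Lemma dvdn_card_iter (v : V) j : iter j f v = 0 -> iter j.-1 f v != 0 ->
  (2 ^ j %| #|V|)%N.
Proof.
move=> v0 vn0; suff H i : (i <= j)%N -> (2 ^ i %| #|iter_ker i|)%N.
  by apply: dvdn_trans (H j (leqnn _)) _; rewrite -cardsT cardSg ?subsetT.
elim: i => [|i IH] ij; first exact: dvd1n.
rewrite expnSr -(Lagrange (iter_kerS i)) dvdn_mul ?IH ?(ltnW ij) //.
have : 2%N.-nat #|iter_ker i.+1 : iter_ker i|%g.
  exact: pnat_dvd (dvdn_indexg _ _) (iter_ker_pgroup _).
have : #|iter_ker i.+1 : iter_ker i|%g != 1%N.
  rewrite indexg_eq1; apply/subsetPn; exists (iter (j - i.+1) f v).
    by rewrite inE -iterD subnKC // v0.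
  by rewrite inE -iterD (_ : i + _ = j.-1)%N //; lia.
by move=> i1 /p_natP[[|l] iE]; rewrite iE ?expnS ?dvdn_mulr // in i1 *.
Qed.

End FiniteTorsion.

(** * Curves [y^2 = x^3 + a x] over a finite field and their [Z[i]]-action *)

HB.instance Definition _ (F : finFieldType) (E : ecurve F) :=
  [Countable of ecpoint E by <:].
HB.instance Definition _ (F : finFieldType) (E : ecurve F) :=
  [Finite of ecpoint E by <:].

Section Lemniscatic.
Variables (F : finFieldType) (E : ecurve F).
Hypothesis Eb : ec_b E = 0.

(** Above [x] lie [1 + qchar (x * (x ^+ 2 + a))] affine points; the extra 1 is the point at
    infinity. *)
Lemma card_ecpoint :
  #|{: ecpoint E}|%:R = #|F|%:R + 1 + jacobsthal (- ec_a E) :> int.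
Proof.
have t0 := ec_two_neq0 E.
pose A := [set z : F * F | on_ec E (Some z)].
have -> : #|{: ecpoint E}| = #|A|.+1.
  rewrite card_sub (@eq_card _ _ (mem (None |: [set Some z | z in A]))).
    rewrite cardsU1 card_imset; last by move=> ? ? [].
    by case: imsetP => // -[].
  case=> [z|]; rewrite !inE //=; apply/idP/imsetP => [hz|[t + [->]]].
    by exists z; rewrite ?inE.
  by rewrite inE.
have -> : #|A| = (\sum_x #|[set y : F | (y ^+ 2 == x * (x ^+ 2 - - ec_a E))%R]|)%N.
  under [RHS]eq_bigr => x _ do rewrite -sum1_card.
  rewrite pair_big_dep -sum1_card /=; apply: eq_bigl => -[x y].
  by rewrite !inE /= Eb; congr (_ == _); ring.
rewrite /jacobsthal; under [in RHS]eq_bigr => x _ do rewrite -qcharM //.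
rewrite /qchar sumrB sumr_const -raddf_sum /= -natr1 natz; ring.
Qed.

Section Mul_i.
Variable i : F.
Hypothesis i2 : i ^+ 2 = -1.

Definition ec_muli_raw (p : option (F * F)) : option (F * F) :=
  if p is Some (x, y) then Some (- x, i * y) else None.

Lemma ec_muli_on p : on_ec E p -> on_ec E (ec_muli_raw p).
Proof.
case: p => [[x y]|] //= /eqP h; apply/eqP.
by rewrite exprMn i2 h Eb; ring.
Qed.

(** Multiplication by [i] carries a chord or tangent of slope [l] to one of slope [- i * l]. *)
Lemma ec_muliD_raw p q : on_ec E p -> on_ec E q ->
  ec_muli_raw (ec_add_raw E p q) = ec_add_raw E (ec_muli_raw p) (ec_muli_raw q).
Proof.
have i0 : i != 0 by apply/eqP => i0; move/eqP: i2; rewrite i0 expr0n eq_sym oppr_eq0 oner_eq0.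
case: p => [[x1 y1]|]; case: q => [[x2 y2]|] // hp hq.
case: (ec_addP hp hq) => [-> ->|l n [e1 e2] _]; first by rewrite /= mulrN !eqxx.
have hl : ec_line E (- i * l) (- x1) (i * y1) (- x2) (i * y2).
  split; first by rewrite -mulrBr e1; ring.
  by rewrite -mulrDr mulrACA mulNr -expr2 i2 opprK mul1r e2; ring.
rewrite [RHS](ec_add_line (ec_muli_on hp) (ec_muli_on hq) _ hl) /=.
  by rewrite exprMn sqrrN i2; congr (Some (_, _)); ring.
by case=> /oppr_inj e3 /eqP; rewrite -mulrN => /eqP /(mulfI i0) e4; apply: n; rewrite e3 e4.
Qed.

Definition ec_muli (p : ecpoint E) : ecpoint E := ECPoint (ec_muli_on (valP p)).

Lemma ec_muliD : {morph ec_muli : p q / p + q}.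
Proof. by move=> p q; apply: val_inj; rewrite /= ec_muliD_raw ?(valP p, valP q). Qed.

Lemma ec_muliK p : ec_muli (ec_muli p) = - p.
Proof.
apply: val_inj; case: p => [[[x y]|] h] //=.
by rewrite opprK mulrA -expr2 i2 mulN1r.
Qed.

Lemma ec_muliMn p n : ec_muli (p *+ n) = ec_muli p *+ n.
Proof.
by elim: n => [|n IH]; [apply: val_inj | rewrite !mulrS ec_muliD IH].
Qed.

Lemma ec_muli_eq0 p : (ec_muli p == 0) = (p == 0).
Proof.
apply/eqP/eqP => [/(congr1 ec_muli)|->]; last exact: val_inj.
have -> : ec_muli 0 = 0 by apply: val_inj.
by rewrite ec_muliK => /eqP; rewrite oppr_eq0 => /eqP.
Qed.

(* In the endomorphism ring [f] is [1 + i], whose square is [2 i]: a point of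
   order [2^(n+1)] is killed by [(1 + i)^(2n+2)] but not by [(1 + i)^(2n)]. *)
Lemma dvdn_card_ecpoint (p : ecpoint E) n : p *+ 2 ^ n.+1 = 0 -> p *+ 2 ^ n != 0 ->
  (2 ^ n.*2.+1 %| #|{: ecpoint E}|)%N.
Proof.
move=> p0 pn0; pose f (q : ecpoint E) := q + ec_muli q.
have fD : {morph f : q r / q + r} by move=> q r; rewrite /f ec_muliD addrACA.
have ff q : f (f q) = ec_muli q *+ 2.
  by rewrite /f ec_muliD ec_muliK addrC addrA subrK mulr2n.
have f0 : f 0 = 0 by rewrite /f add0r; apply/eqP; rewrite ec_muli_eq0.
have f2 q : f q = 0 -> q *+ 2 = 0.
  by move=> q0; apply/eqP; rewrite -ec_muli_eq0 ec_muliMn -ff q0 f0.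
(* [f^(2j)] is [i^j 2^j], and [i] acts injectively. *)
have iter2 j q : (iter j.*2 f q == 0) = (q *+ 2 ^ j == 0).
  have -> : iter j.*2 f q = iter j ec_muli q *+ 2 ^ j.
    elim: j => [|j IH]; first by rewrite mulr1n.
    by rewrite doubleS !iterS ff IH ec_muliMn -mulrnA -expnSr.
  have -> : iter j ec_muli q *+ 2 ^ j = iter j ec_muli (q *+ 2 ^ j).
    by elim: {1 3}j => //= l IH; rewrite -ec_muliMn IH.
  by elim: {1}j => //= l IH; rewrite ec_muli_eq0.
have fn0 : iter n.*2 f p != 0 by rewrite iter2.
have fp0 : iter n.+1.*2 f p = 0 by apply/eqP; rewrite iter2 p0.
(* The first vanishing iterate has index [2n+1] or [2n+2]; both give the factor [2^(2n+1)]. *)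
have [f1|f1] := eqVneq (iter n.*2.+1 f p) 0.
  exact: (dvdn_card_iter fD f2 f1).
apply: dvdn_trans (dvdn_card_iter fD f2 fp0 _); last by [].
by rewrite dvdn_exp2l.
Qed.

End Mul_i.
End Lemniscatic.

(** * Sums of two squares divisible by powers of 2 *)

Lemma int_parity (u : int) : exists w, u = 2 * w \/ u = 2 * w + 1.
Proof. exists (u %/ 2)%Z; lia. Qed.

Lemma even_squares (u v d : int) : u ^+ 2 + v ^+ 2 = 4 * d ->
  exists w z, u = 2 * w /\ v = 2 * z.
Proof.
have [w wE] := int_parity u; have [z zE] := int_parity v; move=> e.
by exists w, z; case: wE zE e => -> [] -> e; split=> //; exfalso; lia.
Qed.

(** Descent: [u] and [v] are both even, and halving them removes one factor 4. *)
Lemma dvdz_sum_squares n (u v : int) :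
  (2 ^+ n.*2.+1 %| u ^+ 2 + v ^+ 2)%Z -> (2 ^+ n %| u)%Z.
Proof.
elim: n u v => [|n IH] u v; first by rewrite expr0 dvd1z.
have -> : 2 ^+ n.+1.*2.+1 = 4 * 2 ^+ n.*2.+1 :> int by rewrite doubleS 2!exprS mulrA.
case/dvdzP=> c; rewrite mulrCA => cE; have [w [z [uE vE]]] := even_squares cE.
rewrite uE exprS dvdz_mul2l //; apply: (IH w z); apply/dvdzP; exists c.
have f0 : 4 != 0 :> int by [].
by apply: (mulfI f0); rewrite -cE uE vE; ring.
Qed.

(** Meant for [q + 1 + s] points over a field of [q] elements, so [s] is minus the trace of
    Frobenius; halving [s] and [b] writes [q] as a sum of two squares. *)
Lemma dvdz_trace n (q s b : int) : (2 ^+ n.*2.+1 %| q + 1 + s)%Z ->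
  s ^+ 2 + b ^+ 2 = 4 * q -> (2 ^+ n.+1 %| q - 1)%Z.
Proof.
move=> d e; have [a' [c [sE bE]]] := even_squares e.
pose a := - a'; have {}sE : s = - 2 * a by rewrite sE /a; ring.
have qE : q = a ^+ 2 + c ^+ 2.
  have f0 : 4 != 0 :> int by [].
  by apply: (mulfI f0); rewrite -e sE bE; ring.
have a1 : (2 ^+ n %| a - 1)%Z.
  apply: (@dvdz_sum_squares n _ c); suff <- : q + 1 + s = (a - 1) ^+ 2 + c ^+ 2 by [].
  by rewrite sE qE; ring.
have -> : q - 1 = q + 1 + s + 2 * (a - 1) by rewrite sE; ring.
apply: rpredD; last by rewrite exprS dvdz_mul2l.
by apply: dvdz_trans d; apply: dvdz_exp2l; lia.
Qed.

(** * Residues modulo 4 and square roots of -1 *)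

Lemma eqz_mod4_odd (p : nat) (c : int) : c ^+ 2 = 1 -> (p%:Z = c %[mod 4])%Z -> odd p.
Proof.
move=> c1 /eqP; rewrite eqz_mod_dvd => /dvdzP[d dE].
have : (c == 1) || (c == -1) by rewrite -sqrf_eq1 c1.
by case/orP=> /eqP cE; subst c; lia.
Qed.

(** If [g] generates the multiplicative group, of order [4 d], then [g ^+ d] has order 4 and its
    square is -1. *)
Lemma sqrt_opp1_ex (F : finFieldType) : (4 %| #|F|.-1)%N -> exists i : F, i ^+ 2 = -1.
Proof.
case/dvdnP=> d dE.
have F1 : (1 < #|F|)%N := card_finRing_gt1 F.
have q0 : (0 < #|F|.-1)%N by lia.
pose rs := [seq x <- enum F | x != 0].
have U x : x != 0 -> x ^+ #|F|.-1 = 1 :> F.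
  by move=> x0; apply: (mulfI x0); rewrite mulr1 -exprS prednK ?expf_card // ltnW.
have : has (#|F|.-1).-primitive_root rs.
  apply: has_prim_root => //.
  - by apply/allP => x; rewrite mem_filter => /andP[x0 _]; rewrite unity_rootE U.
  - by rewrite filter_uniq ?enum_uniq.
  - rewrite -(cardC1 (0 : F)) -(card_uniqP (filter_uniq _ (enum_uniq _))).
    by apply/subset_leq_card/subsetP => x; rewrite !inE mem_filter mem_enum andbT.
case/hasP=> g _ gP; exists (g ^+ d).
have : (g ^+ d ^+ 2) ^+ 2 = 1 by rewrite -(prim_expr_order gP) dE -!exprM.
move/eqP; rewrite sqrf_eq1 => /orP[|/eqP //].
rewrite -exprM -(prim_order_dvd gP) dE => /dvdn_leq; lia.
Qed.

(** For [q = 3] modulo 4, a root would satisfy [i^q = - i], against [i^q = i]. *)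
Lemma sqr_neq_opp1 (F : finFieldType) : 2%:R != 0 :> F -> (4 %| #|F|.+1)%N ->
  forall i : F, i ^+ 2 != -1.
Proof.
move=> t0 /dvdnP[d dE] i; apply/eqP => i2.
have : i ^+ #|F| = - i.
  have -> : #|F| = (4 * d.-1 + 3)%N by lia.
  rewrite exprD exprM (exprM i 2 2) i2 sqrrN !expr1n mul1r exprSr i2 mulN1r //.
rewrite expf_card => iN; have /(neq_opp t0) : i != 0.
  by apply/eqP => i0; move/eqP: i2; rewrite i0 expr0n eq_sym oppr_eq0 oner_eq0.
by rewrite -iN eqxx.
Qed.

(** * Duplication formula with cleared denominators *)

Lemma ec_double (K : fieldType) (E : ecurve K) (Q : ecpoint E) x y :
  ec_coords Q = Some (x, y) -> y != 0 ->
  let l := (3%:R * x ^+ 2 + ec_a E) / (2%:R * y) in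
  ec_coords (Q + Q) = Some (l ^+ 2 - x - x, l * (x - (l ^+ 2 - x - x)) - y).
Proof.
move=> hQ y0 l; have h := valP Q; rewrite /= hQ in h.
rewrite /= hQ (@ec_add_line _ E l) //; last exact: ec_line_tangent.
by case=> /eqP; rewrite -addr_eq0 -mulr2n -mulr_natl mulf_eq0 (negbTE (ec_two_neq0 E)) (negbTE y0).
Qed.

(** Duplication of [(m / e^2, n / e^3)] on [y^2 = x^3 - 2x], over any ring so that it passes from
    the rationals to the integers and on to ['F_p]. *)
Definition double_eqs (R : pzRingType) (m n e m' n' e' : R) :=
  m' * (2%:R * n * e) ^+ 2 =
    e' ^+ 2 * ((3%:R * m ^+ 2 - 2%:R * e ^+ 4) ^+ 2 - 8%:R * m * n ^+ 2) /\
  n' * (2%:R * n * e ^+ 3) =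
    (3%:R * m ^+ 2 - 2%:R * e ^+ 4) * (m * e' ^+ 3 - m' * e ^+ 2 * e')
    - 2%:R * n ^+ 2 * e' ^+ 3.

Lemma double_eqsP (K : fieldType) (E : ecurve K) (Q : ecpoint E) m n e m' n' e' :
  ec_a E = - 2%:R -> n != 0 -> e != 0 -> e' != 0 ->
  ec_coords Q = Some (m / e ^+ 2, n / e ^+ 3) ->
  ec_coords (Q + Q) = Some (m' / e' ^+ 2, n' / e' ^+ 3) <->
  double_eqs m n e m' n' e'.
Proof.
move=> Ea n0 e0 e0' hQ; have t0 := ec_two_neq0 E.
have y0 : n / e ^+ 3 != 0 by rewrite mulf_neq0 ?invr_neq0 ?expf_neq0.
rewrite (ec_double hQ y0) Ea; split=> [[hx hy]|[hm hn]].
  split.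
    rewrite -[m'](mulfVK (expf_neq0 2 e0')) -hx; field; rewrite ?t0 ?n0 ?e0 //.
  have -> : n' = n' / e' ^+ 3 * e' ^+ 3 by field.
  rewrite -hy hx; field; rewrite ?t0 ?n0 ?e0 ?e0' //.
have d1 : 2%:R * n * e != 0 by rewrite !mulf_neq0.
have d2 : 2%:R * n * e ^+ 3 != 0 by rewrite !mulf_neq0 ?expf_neq0.
have mE := canRL (mulfK (expf_neq0 2 d1)) hm.
have nE := canRL (mulfK d2) hn.
by rewrite nE mE; congr (Some (_, _)); field; rewrite ?t0 ?n0 ?e0 ?e0'.
Qed.

Lemma ec_double_y0 (K : fieldType) (E : ecurve K) (Q : ecpoint E) x :
  ec_coords Q = Some (x, 0) -> Q + Q = 0.
Proof. by move=> hQ; apply: val_inj; rewrite /= hQ /= oppr0 !eqxx. Qed.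

Lemma fraction_eq (Q : ecpoint ecE) m n e : ec_fraction Q m n e ->
  n ^+ 2 = m ^+ 3 - 2%:R * m * e ^+ 4.
Proof.
move=> [e1 _ _ hQ]; have := valP Q; rewrite /= hQ /= addr0 => /eqP h.
have e0 : e%:Q != 0 by rewrite intr_eq0 gt_eqF // gtz0_ge1.
apply: (@intr_inj rat); rewrite !(rmorphXn, rmorphM, rmorphB) /=.
transitivity ((n%:Q / e%:Q ^+ 3) ^+ 2 * e%:Q ^+ 6); first by field.
by rewrite h; field.
Qed.

Lemma double_eqs_intr (R : pzRingType) (m n e m' n' e' : int) :
  double_eqs m n e m' n' e' ->
  double_eqs (m%:~R : R) n%:~R e%:~R m'%:~R n'%:~R e'%:~R.
Proof.
case=> /(congr1 (intr : int -> R)) hm /(congr1 (intr : int -> R)) hn.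
by move: hm hn; rewrite !(rmorphXn, rmorphM, rmorphB) /=; split.
Qed.

Lemma intr_double_eqs (m n e m' n' e' : int) :
  double_eqs (m%:Q) n%:Q e%:Q m'%:Q n'%:Q e'%:Q -> double_eqs m n e m' n' e'.
Proof.
by case=> hm hn; split; apply: (@intr_inj rat); rewrite !(rmorphXn, rmorphM, rmorphB).
Qed.

(** * Reduction of the points [2^k P] modulo an odd prime *)

Section Reduction.
Variables (p : nat) (p_prime : prime p) (p_odd : odd p).

Let dvdp (z : int) : (p%:Z %| z)%Z = (z%:~R == 0 :> 'F_p).
Proof. exact: dvdz_pcharf (pchar_Fp p_prime) z. Qed.

Lemma two_neq0_Fp : 2%:R != 0 :> 'F_p.
Proof.
rewrite -(dvdn_pcharf (pchar_Fp p_prime)); apply/negP => /dvdn_leq p2.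
have := prime_gt1 p_prime; lia.
Qed.

Fact ecEp_disc : - 16%:R * (4%:R * (- 2%:R) ^+ 3 + 27%:R * 0 ^+ 2) != 0 :> 'F_p.
Proof.
have -> : - 16%:R * (4%:R * (- 2%:R) ^+ 3 + 27%:R * 0 ^+ 2) = 2%:R ^+ 9 :> 'F_p by ring.
exact: expf_neq0 two_neq0_Fp.
Qed.
Definition ecEp : ecurve 'F_p := ECurve ecEp_disc.

Fact ecPp_on : on_ec ecEp (Some (2%:R, 2%:R)).
Proof. by apply/eqP => /=; ring. Qed.
Definition ecPp : ecpoint ecEp := ECPoint ecPp_on.

(** Meaningful only for [e] nonzero in ['F_p]; otherwise both quotients default to 0. *)
Definition red_point (m n e : int) : option ('F_p * 'F_p) :=
  Some (m%:~R / e%:~R ^+ 2, n%:~R / e%:~R ^+ 3).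

Let f0 : 4%:R != 0 :> 'F_p.
Proof. by rewrite (_ : 4%:R = 2%:R * 2%:R) ?mulf_neq0 ?two_neq0_Fp // -natrM. Qed.

Let coprime_neq0 (a b : int) : coprimez a b -> b%:~R = 0 :> 'F_p -> a%:~R != 0 :> 'F_p.
Proof.
move=> cab /eqP; rewrite -!dvdp => pb; apply/negP => pa.
have : (p%:Z %| gcdz a b)%Z by rewrite dvdz_gcd pa.
rewrite (eqP cab) dvdz1 /= => /eqP p1.
by move: p_prime; rewrite p1.
Qed.

Section Double.
Variables (Q : ecpoint ecE) (Q' : ecpoint ecEp) (m n e m' n' e' : int).
Hypotheses (hQ : ec_fraction Q m n e) (hQ2 : ec_fraction (Q + Q) m' n' e').
Hypothesis hQ' : ec_coords Q' = red_point m n e.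

Let dfr : 4%:R * m'%:~R * n%:~R ^+ 2 * e%:~R ^+ 2 =
  e'%:~R ^+ 2 * (m%:~R ^+ 2 + 2%:R * e%:~R ^+ 4) ^+ 2 :> 'F_p.
Proof.
have /(congr1 (intr : int -> 'F_p)) := double_fraction hQ hQ2.
by rewrite !(rmorphXn, rmorphM, rmorphD).
Qed.

(** The relations [double_eqs] hold over the integers, hence modulo [p], where they determine the
    double. *)
Lemma red_double : e%:~R != 0 :> 'F_p -> e'%:~R != 0 :> 'F_p ->
  ec_coords (Q' + Q') = red_point m' n' e'.
Proof.
move=> e0 e0'.
(* Otherwise the duplication relation gives [m^2 = - 2 e^4] and the curve equation [m^3 = 2 m e^4];
   together they force [m = 0] and then [2 e^4 = 0]. *)
have n0 : n%:~R != 0 :> 'F_p.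
  apply/eqP => n0; have /eqP := dfr; rewrite n0 expr0n /= mulr0 mul0r eq_sym.
  rewrite mulf_eq0 !expf_eq0 /= (negbTE e0') /= addr_eq0 => /eqP h1.
  have h2 : m%:~R ^+ 3 - 2%:R * m%:~R * e%:~R ^+ 4 = 0 :> 'F_p.
    have /(congr1 (intr : int -> 'F_p)) := fraction_eq hQ.
    by rewrite !(rmorphXn, rmorphM, rmorphB) /= n0 expr0n => <-.
  have : 4%:R * m%:~R * e%:~R ^+ 4 = 0 :> 'F_p.
    by rewrite -[RHS]oppr0 -[in RHS]h2 [m%:~R ^+ 3]exprS h1; ring.
  move/eqP; rewrite mulf_eq0 expf_eq0 mulf_eq0 (negbTE f0) (negbTE e0) /= orbF => /eqP m0.
  move/eqP: h1; rewrite m0 expr0n eq_sym oppr_eq0 mulf_eq0 expf_eq0.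
  by rewrite (negbTE two_neq0_Fp) (negbTE e0).
case: (hQ) (hQ2) => e1 _ _ hv [e1' _ _ hv2].
have [_] := @double_eqsP _ ecEp Q' _ _ _ m'%:~R n'%:~R _ (erefl _) n0 e0 e0' hQ'.
apply; apply: double_eqs_intr.
apply: intr_double_eqs; apply/(@double_eqsP _ ecE Q _ _ _ _ _ _ _ _ _ _ hv) => //; rewrite intr_eq0.
- by apply: contraNneq n0 => ->.
- by rewrite gt_eqF // gtz0_ge1.
- by rewrite gt_eqF // gtz0_ge1.
Qed.

(** As [m'] is prime to [p], the duplication relation forces [n = 0] modulo [p]: the reduced point
    has [y = 0]. *)
Lemma red_double0 : e%:~R != 0 :> 'F_p -> e'%:~R = 0 :> 'F_p -> Q' + Q' = 0.
Proof.
move=> e0 e0'; case: (hQ2) => _ /coprime_neq0 /(_ e0') m0' _ _.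
have /eqP := dfr; rewrite e0' expr0n mul0r !(expf_eq0, mulf_eq0) /=.
rewrite (negbTE f0) (negbTE m0') (negbTE e0) /= orbF => /eqP n0.
by apply: (@ec_double_y0 _ _ _ (m%:~R / e%:~R ^+ 2)); rewrite hQ' /red_point n0 mul0r.
Qed.

End Double.

Variables (m n e : nat -> int).
Hypothesis hmne : pow2_fractions ecP m n e.

Let frac_double k : ec_fraction (ecP *+ 2 ^ k + ecP *+ 2 ^ k) (m k.+1) (n k.+1) (e k.+1).
Proof. by have := hmne k.+1; rewrite expnS mulnC mulrnA mulr2n. Qed.

(** Divide the duplication relation by [e_k^2]: [4 m_(k+1) n_k^2 = F_(k+1)^2 (m_k^2 + 2 e_k^4)^2].
    If [p] divided [e_k], coprimality would make the left side nonzero modulo [p], but the right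
    side vanishes. *)
Lemma ecF_neq0 k : (p%:Z %| ecF e k.+1)%Z -> (e k)%:~R != 0 :> 'F_p.
Proof.
rewrite dvdp => /eqP F0; apply/eqP => e0; have eF := ecF_mul hmne k.
have [e1 _ nk _] := hmne k; have [_ mk _ _] := frac_double k.
have ek0 : e k != 0 by rewrite gt_eqF // gtz0_ge1.
have /(congr1 (intr : int -> 'F_p)) : 4%:R * m k.+1 * n k ^+ 2 =
   ecF e k.+1 ^+ 2 * (m k ^+ 2 + 2%:R * e k ^+ 4) ^+ 2.
  apply: (mulIf (expf_neq0 2 ek0)); rewrite (double_fraction (hmne k) (frac_double k)).
  by rewrite -eF; ring.
rewrite !(rmorphXn, rmorphM) /= F0 expr0n mul0r => /eqP.
rewrite !(expf_eq0, mulf_eq0) (negbTE f0) (negbTE (coprime_neq0 nk e0)) orbF /=.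
have e0' : (e k.+1)%:~R = 0 :> 'F_p by rewrite -eF rmorphM /= e0 mulr0.
exact/negP/(coprime_neq0 mk e0').
Qed.

Lemma denominator_neq0 k j : (j <= k)%N -> (e k)%:~R != 0 :> 'F_p ->
  (e j)%:~R != 0 :> 'F_p.
Proof.
move=> jk; rewrite -!dvdp; apply: contra => /dvdz_trans; apply.
rewrite -(subnK jk); elim: (k - j)%N => [|i IH]; first exact: dvdzz.
exact: dvdz_trans IH (dvd_denominators hmne _).
Qed.

Lemma red_pow2 k : (e k)%:~R != 0 :> 'F_p ->
  ec_coords (ecPp *+ 2 ^ k) = red_point (m k) (n k) (e k).
Proof.
elim: k => [|k IH] e0; last first.
  have ek0 := denominator_neq0 (leqnSn k) e0.
  rewrite expnS mulnC mulrnA mulr2n.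
  exact: red_double (hmne k) (frac_double k) (IH ek0) ek0 e0.
(* At index 0 only the quotients are given, so a factor [e 0] has to be cancelled to find
   [(2, 2)]. *)
have [e1 cm cn] := hmne 0%N; rewrite expn0 mulr1n /= => -[hx hy].
have e0Q : (e 0%N)%:Q != 0 by rewrite intr_eq0 gt_eqF // gtz0_ge1.
have mE : m 0%N = 2 * e 0%N ^+ 2.
  apply: (@intr_inj rat); rewrite !(rmorphXn, rmorphM) /= [X in X * _]hx.
  by rewrite mulfVK // expf_neq0.
have nE : n 0%N = 2 * e 0%N ^+ 3.
  apply: (@intr_inj rat); rewrite !(rmorphXn, rmorphM) /= [X in X * _]hy.
  by rewrite mulfVK // expf_neq0.
rewrite /red_point mE nE !(rmorphXn, rmorphM) /=.
by rewrite !mulfK ?expf_neq0.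
Qed.

Lemma red_order k : (p%:Z %| ecF e k.+1)%Z ->
  ecPp *+ 2 ^ k.+1 = 0 /\ ecPp *+ 2 ^ k != 0.
Proof.
move=> pF; have e0 := ecF_neq0 pF; have hk := red_pow2 e0; split; last first.
  by apply/eqP => P0; move: hk; rewrite P0.
rewrite expnS mulnC mulrnA mulr2n.
apply: red_double0 (hmne k) (frac_double k) hk e0 _.
by move: pF; rewrite dvdp => /eqP F0; rewrite -(ecF_mul hmne k) rmorphM /= F0 mul0r.
Qed.

End Reduction.

(** * Point order against point count in the two classes modulo 4 *)

Theorem theorem1p11 (m n e : nat -> int) (hmne : pow2_fractions ecP m n e)
  (k p : nat) (hp : prime p) (hpF : (p%:Z %| ecF e k)%Z) :
  ((p%:Z = 1 %[mod 4])%Z -> (p%:Z = 1 %[mod 2 ^+ k])%Z) /\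
  ((p%:Z = - 1 %[mod 4])%Z -> (p%:Z = - 1 %[mod 2 ^+ k])%Z).
Proof.
case: k hpF => [_|k pF]; first by rewrite expr0 !modz1.
split=> /[dup] p4 /eqz_mod4_odd -/(_ erefl) p_odd; apply/eqP; rewrite eqz_mod_dvd;
  have [P0 Pn0] := red_order hp p_odd hmne pF;
  have t0 := two_neq0_Fp hp p_odd;
  have b0 : ec_b (ecEp hp p_odd) = 0 by [];
  have := card_ecpoint b0;
  rewrite (card_Fp hp) /= opprK => cE.
- have [|i i2] := @sqrt_opp1_ex ('F_p).
    by rewrite card_Fp //; move/eqP: p4; rewrite eqz_mod_dvd => /dvdzP[d dE]; lia.
  have qN1 : qchar (-1 : 'F_p) = 1.
    rewrite -i2 qchar_sqr //; apply/eqP => i0; move/eqP: i2.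
    by rewrite i0 expr0n eq_sym oppr_eq0 oner_eq0.
  (* [t0] serves twice: the characteristic is not 2, and the parameter [d = 2] is nonzero. *)
  have [b] := jacobsthal_two_squares t0 t0 qN1; rewrite card_Fp // (natz p) => bE.
  apply: dvdz_trace bE; rewrite !natz in cE; rewrite -cE.
  have := dvdn_card_ecpoint b0 i2 P0 Pn0.
  by rewrite dvdzE abszX.
(* As -1 is not a square, [jacobsthal_opp] reads [J = - J] over the integers. *)
- have J0 : jacobsthal (2%:R : 'F_p) = 0.
    have := jacobsthal_opp t0 (2%:R : 'F_p).
    rewrite (qchar_nonsqr (sqr_neq_opp1 t0 _)) ?mulN1r => [|]; last first.
      by rewrite card_Fp //; move/eqP: p4; rewrite eqz_mod_dvd => /dvdzP[d dE]; lia.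
    by move/eqP; rewrite -addr_eq0 -mulr2n mulrn_eq0 => /eqP.
  rewrite J0 addr0 !natz in cE; rewrite opprK -cE.
  have := dvdn_card_order P0 Pn0.
  by rewrite dvdzE abszX.
Qed.
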